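(* Let $\mathcal{Z}$ be a finite nonempty set and fix a data point $x$. Let $f_\theta(x,\cdot):\mathcal{Z}\to\mathbb{R}$ be a function (not depending on $\phi$), and for each parameter $\phi\in\mathbb{R}^d$ let $h_\phi(x,\cdot):\mathcal{Z}\to\mathbb{R}$ be a function such that, for every $z\in\mathcal{Z}$, the map $\phi\mapsto h_\phi(x,z)$ is smooth. Let $\gamma=(\gamma(z))_{z\in\mathcal{Z}}$ be a family of independent zero-mean Gumbel random variables. Define the random variables $$z^{*}\triangleq\arg\max_{\hat z\in\mathcal{Z}}\{h_\phi(x,\hat z)+\gamma(\hat z)\},\qquad z^{*}(\epsilon)\triangleq\arg\max_{\hat z\in\mathcal{Z}}\{\epsilon f_\theta(x,\hat z)+h_\phi(x,\hat z)+\gamma(\hat z)\},\quad \epsilon\in\mathbb{R}.$$ Then, for every $\phi\in\mathbb{R}^d$, $$\nabla_\phi\,\mathbb{E}_{\gamma}\big[f_\theta(x,z^{*})\big]=\lim_{\epsilon\to 0}\frac{1}{\epsilon}\Big(\mathbb{E}_{\gamma}\big[\nabla_\phi h_\phi(x,z^{*}(\epsilon))-\nabla_\phi h_\phi(x,z^{*})\big]\Big).$$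
   Context: The zero-mean Gumbel distribution is the law on $\mathbb{R}$ with density $t\mapsto e^{-(t+c+e^{-(t+c)})}$, where $c\approx 0.57$ is the Euler(–Mascheroni) constant; thus $\gamma$ has joint density $g(\gamma)=\prod_{z\in\mathcal{Z}}e^{-(\gamma(z)+c+e^{-(\gamma(z)+c)})}$ on $\mathbb{R}^{\mathcal{Z}}$, and $\mathbb{E}_\gamma$ denotes expectation with respect to it. The maximizers defining $z^*$ and $z^*(\epsilon)$ depend on $\gamma$ and $\phi$. They are unique outside a set of $\gamma$ of measure zero, and such null sets are ignored (any choice of maximizer may be made there). The notation $\nabla_\phi h_\phi(x,z^{*}(\epsilon))$ means the gradient of $\phi\mapsto h_\phi(x,z)$ with $z$ held fixed, evaluated at $z=z^{*}(\epsilon)$ (i.e. the dependence of $z^*(\epsilon)$ on $\phi$ is not differentiated); similarly for $\nabla_\phi h_\phi(x,z^{*})$. On the left-hand side, by contrast, $\nabla_\phi$ is the gradient of the full function $\phi\mapsto\mathbb{E}_\gamma[f_\theta(x,z^* )]$, with $z^*$ depending on $\phi$. *)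

(* Defs.v *)
From HB Require Import structures.
From mathcomp Require Import all_boot all_order all_algebra.
From mathcomp Require Import all_classical all_reals all_analysis.

Set Implicit Arguments.
Unset Strict Implicit.
Unset Printing Implicit Defensive.

Import Order.TTheory GRing.Theory Num.Theory.
Import numFieldNormedType.Exports.

Local Open Scope classical_set_scope.
Local Open Scope ring_scope.

Definition euler_constant (R : realType) : R :=
  limn (fun n => (\sum_(1 <= k < n.+1) k%:R^-1) - ln n%:R : R).

Definition gumbel0_pdf (R : realType) (t : R) : R :=
  let u := t + euler_constant R in expR (- (u + expR (- u))).

Definition gumbel0_distributed (R : realType) (dT : measure_display)
    (T : measurableType dT) (P : probability T R) (X : {RV P >-> R}) : Prop :=
  forall A : set R, measurable A ->
    distribution P X A
    = (\int[@lebesgue_measure R]_(t in A) (gumbel0_pdf t)%:E)%E.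

Definition independent_family (R : realType) (dT : measure_display)
    (T : measurableType dT) (P : probability T R) (I : finType)
    (X : I -> {RV P >-> R}) : Prop :=
  forall (S : {set I}) (A : I -> set R), (forall i, measurable (A i)) ->
    P [set w | forall i, i \in S -> A i (X i w)]
    = (\prod_(i in S) P (X i @^-1` A i))%E.

(* Ties are broken arbitrarily.  On the finite set [Z], measurability of the
   preimages of points is measurability for the discrete sigma-algebra. *)
Definition argmax_rv (R : realType) (dT : measure_display)
    (T : measurableType dT) (Z : finType) (u : T -> Z -> R) (zs : T -> Z) :
    Prop :=
  (forall z, measurable (zs @^-1` [set z]))
  /\ (forall w z, u w z <= u w (zs w)).

Definition partial (R : realType) (d : nat) (i : 'I_d) (f : 'rV[R]_d -> R) :
    'rV[R]_d -> R :=
  fun p => 'D_(delta_mx ord0 i) f p.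

Definition gradient (R : realType) (d : nat) (f : 'rV[R]_d -> R)
    (p : 'rV[R]_d) : 'rV[R]_d :=
  \row_i partial i f p.

(* The case [s = [::]] says that [f] itself is differentiable. *)
Definition smooth (R : realType) (d : nat) (f : 'rV[R]_d -> R) : Prop :=
  forall (s : seq 'I_d) (p : 'rV[R]_d),
    differentiable (foldr (@partial R d) f s) p.

Definition expectation_rV (R : realType) (dT : measure_display)
    (T : measurableType dT) (P : probability T R) (d : nat)
    (X : T -> 'rV[R]_d) : 'rV[R]_d :=
  \row_i fine 'E_P[fun w => X w ord0 i].

(* Main.v *)
(* Gumbel-max trick: if g is Gumbel then exp(-(g + c + u)) is exponential with
   rate exp u, so the maximizer of u z + gamma z is the winner of an exponential
   race, and it equals z with probability softmax u z.  To avoid integrating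
   against the joint law, the race is discretized with a time step s: summing
   over the step in which z wins gives a geometric series, which bounds the
   probability by softmax u z * (1 + O(s)).  Both sides of the identity are then
   derivatives of softmax means: with p = softmax (h phi), the left-hand side is
   the p-covariance of f and grad h, and so is the derivative at eps = 0 of the
   mean of grad h under softmax (eps f + h phi), by symmetry. *)
Require Import Defs.
From HB Require Import structures.
From mathcomp Require Import all_boot all_order all_algebra.
From mathcomp Require Import all_classical all_reals all_analysis.
From mathcomp Require Import measurable_realfun ring lra.

Set Implicit Arguments.
Unset Strict Implicit.
Unset Printing Implicit Defensive.

Import Order.TTheory GRing.Theory Num.Theory.
Import numFieldNormedType.Exports.

Local Open Scope classical_set_scope.
Local Open Scope ring_scope.

(** * Tails of the Gumbel law and of its exponential transform *)

(** The function [G] below is an antiderivative of the density and tends to 1 at infinity. *)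
Lemma gumbel0_ge (R : realType) (dT : measure_display) (T : measurableType dT)
    (P : probability T R) (X : {RV P >-> R}) (t : R) :
  gumbel0_distributed X ->
  P [set w | t <= X w]
  = (1 - expR (- expR (- (t + euler_constant R))))%:E.
Proof.
move=> /(_ `[t, +oo[%classic (measurable_itv `[t, +oo[)).
rewrite /distribution /pushforward /=.
set G := fun x : R => expR (- expR (- (x + euler_constant R))).
have dG (x : R) : is_derive x 1 G (gumbel0_pdf x).
  rewrite /G; apply: is_derive_eq.
  rewrite /gumbel0_pdf [in RHS]opprD [in RHS]expRD /GRing.scale/= addr0; ring.
have cG : continuous G.
  by move=> x; apply/differentiable_continuous/derivable1_diffP; case: (dG x).
rewrite (_ : _ @^-1` _ = [set w | t <= X w]); last first.
  by apply/seteqP; split=> w /=; rewrite in_itv/= andbT.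
move=> ->.
rewrite (@ge0_continuous_FTC2y _ _ G t 1).
- by rewrite -EFinB.
- by move=> x _; apply: expR_ge0.
- apply: continuous_subspaceT => x; rewrite /gumbel0_pdf.
  have c1 : {for x, continuous (fun x : R => x + euler_constant R)}.
    by apply: cvgD; [exact: cvg_id | exact: cvg_cst].
  have c2 : {for x, continuous (fun x : R => - (x + euler_constant R))}.
    exact: cvgN.
  apply: continuous_comp; last exact: continuous_expR.
  apply: cvgN; apply: cvgD; first exact: c1.
  by apply: (continuous_comp c2); exact: continuous_expR.
- rewrite -[X in _ --> X]expR0; rewrite /G.
  apply: (@continuous_cvg _ _ _ _ _
    (fun x => - expR (- (x + euler_constant R))) expR).
    exact: continuous_expR.
  rewrite -[X in _ --> X]oppr0; apply: cvgN.
  apply: (@cvg_comp _ _ _ (fun x : R => x + euler_constant R)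
    (fun x => expR (- x)) _ +oo%R).
    apply/cvgryPge => A; near=> x.
    by rewrite -lerBlDr; near: x; apply: nbhs_pinfty_ge; rewrite num_real.
  exact: cvgr_expR.
- by move=> x _; case: (dG x).
- by apply/cvg_at_right_filter/cG.
- by move=> x _; rewrite derive1E; apply: derive_val.
Unshelve. all: by end_near.
Qed.

Lemma gumbel0_exponential_tail (R : realType) (dT : measure_display)
    (T : measurableType dT) (P : probability T R) (X : {RV P >-> R}) (u s : R) :
  gumbel0_distributed X -> 0 <= s ->
  P [set w | s < expR (- (X w + euler_constant R + u))]
  = (expR (- (expR u * s)))%:E.
Proof.
move=> gX; rewrite le_eqVlt => /predU1P[<-|s0].
  rewrite mulr0 oppr0 expR0 (_ : [set _ | _] = setT) ?probability_setT//.
  by apply/seteqP; split=> // w _ /=; apply: expR_gt0.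
(* [t] solves [expR (- (t + c + u)) = s] with [c] the Euler constant. This needs [0 < s], hence the
   separate case [s = 0]. *)
set t := - ln s - u - euler_constant R.
rewrite (_ : [set _ | _] = ~` [set w | t <= X w]).
  have mge : measurable [set w | t <= X w].
    have := @measurable_funPTI _ _ _ _ X `[t, +oo[%classic (measurable_itv _).
    by congr measurable; apply/seteqP; split=> w /=; rewrite in_itv/= andbT.
  rewrite probability_setC// gumbel0_ge// -EFinB; congr EFin.
  rewrite opprB addrCA subrr addr0 /t; congr (expR (- _)).
  rewrite (_ : - _ = u + ln s); last by ring.
  by rewrite expRD lnK.
apply/seteqP; split => w /=; rewrite -{1}(lnK s0) ltr_expR /t => h.
  by apply/negP; lra.
move/negP: h; lra.
Qed.

(** * Softmax and its derivatives *)

Definition softmax (R : realType) (Z : finType) (u : Z -> R) (z : Z) : R :=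
  expR (u z) / \sum_y expR (u y).

(** The point [z] witnesses that [Z] is nonempty. *)
Lemma sum_expR_gt0 (R : realType) (Z : finType) (u : Z -> R) (z : Z) :
  0 < \sum_y expR (u y).
Proof.
by rewrite (bigD1 z)//= ltr_wpDr ?expR_gt0// sumr_ge0// => y _; apply: expR_ge0.
Qed.

Lemma sum_softmax (R : realType) (Z : finType) (u : Z -> R) (z : Z) :
  \sum_y softmax u y = 1.
Proof. by rewrite -mulr_suml divff// gt_eqF// (sum_expR_gt0 u z). Qed.

Section softmax_calculus.
Context {R : realType} {Z : finType} {V : normedModType R}.
(** A general space [V] lets the same formulas serve for the parameter [phi] and for the scalar
    [eps]. *)
Variables (u : Z -> V -> R) (x : V).
Hypothesis du : forall z, differentiable (u z) x.

Let diff_sum_fct (g : Z -> V -> R) : (forall z, differentiable (g z) x) ->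
  differentiable (fun y => \sum_z g z y) x.
Proof.
move=> dg.
rewrite (_ : (fun y => _) = \sum_z g z).
  2: by apply/funext => y; rewrite fct_sumE.
by elim/big_ind : _ => // f h; exact: differentiableD.
Qed.

Let derive_sum_fct (g : Z -> V -> R) (v : V) :
  (forall z, differentiable (g z) x) ->
  'D_v (fun y => \sum_z g z y) x = \sum_z 'D_v (g z) x.
Proof.
move=> dg.
rewrite (_ : (fun y => _) = \sum_z g z).
  2: by apply/funext => y; rewrite fct_sumE.
suff: is_derive x v (\sum_z g z) (\sum_z 'D_v (g z) x).
  by move=> ?; apply: derive_val.
elim/big_ind2 : _ => [|f df h dh|z _]; first exact: is_derive_cst.
  exact: is_deriveD.
exact/derivableP/diff_derivable.
Qed.

Let diff_exp z : differentiable (fun y => expR (u z y)) x.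
Proof.
apply: (@differentiable_comp _ _ _ _ (u z) expR) => //.
exact/derivable1_diffP/derivable_expR.
Qed.

Let derive_exp (z : Z) (v : V) :
  'D_v (fun y => expR (u z y)) x = expR (u z x) * 'D_v (u z) x.
Proof.
rewrite !deriveE//.
rewrite (@diff_comp _ _ _ _ (u z) expR)//=; last first.
  exact/derivable1_diffP/derivable_expR.
rewrite diff1E; last exact/derivable1_diffP/derivable_expR.
rewrite derive1E.
have -> : 'D_1 expR (u z x) = expR (u z x) by apply: derive_val.
by rewrite /GRing.scale/= mulrC.
Qed.

Let sum_neq0 (z : Z) : \sum_y expR (u y x) != 0.
Proof. by rewrite gt_eqF// (sum_expR_gt0 (fun y => u y x) z). Qed.

Lemma differentiable_softmax (z : Z) :
  differentiable (fun y => softmax (u^~ y) z) x.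
Proof.
apply: (@differentiableM _ _ (fun y => expR (u z y))
  (fun y => (\sum_z' expR (u z' y))^-1)) => //.
apply: differentiableV; first exact: diff_sum_fct.
exact: sum_neq0.
Qed.

(** Quotient rule: the logarithmic derivative of softmax is the derivative of [u z] minus its
    softmax mean. *)
Lemma derive_softmax (z : Z) (v : V) :
  'D_v (fun y => softmax (u^~ y) z) x =
  softmax (u^~ x) z *
  ('D_v (u z) x - \sum_y softmax (u^~ x) y * 'D_v (u y) x).
Proof.
have n0 := sum_neq0 z.
have dS : differentiable (fun y => \sum_z' expR (u z' y)) x.
  exact: diff_sum_fct.
rewrite (@deriveM _ _ (fun y => expR (u z y))
  (fun y => (\sum_z' expR (u z' y))^-1)); last 2 first.
- exact: diff_derivable.
- by apply: derivableV => //; apply: diff_derivable.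
rewrite deriveV//; last exact: diff_derivable.
have -> : 'D_v (fun y => \sum_z' expR (u z' y)) x
          = \sum_y expR (u y x) * 'D_v (u y) x.
  by rewrite derive_sum_fct//; apply: eq_bigr => y _; exact: derive_exp.
have -> : \sum_y softmax (u^~ x) y * 'D_v (u y) x
          = (\sum_y expR (u y x))^-1 * \sum_y expR (u y x) * 'D_v (u y) x.
  by rewrite mulr_sumr; apply: eq_bigr => y _; rewrite /softmax; ring.
by rewrite derive_exp /GRing.scale/= /softmax; field.
Qed.

Lemma differentiable_softmax_mean (a : Z -> R) :
  differentiable (fun y => \sum_z a z * softmax (u^~ y) z) x.
Proof.
apply: (diff_sum_fct (g := fun z y => a z * softmax (u^~ y) z)) => z.
exact/differentiableZ/differentiable_softmax.
Qed.

(** The right-hand side is the softmax covariance of [a] and the derivative of [u], which is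
    symmetric in the two. *)
Lemma derive_softmax_mean (a : Z -> R) (v : V) :
  'D_v (fun y => \sum_z a z * softmax (u^~ y) z) x =
  \sum_z softmax (u^~ x) z * (a z * 'D_v (u z) x) -
  (\sum_z softmax (u^~ x) z * a z) *
  (\sum_z softmax (u^~ x) z * 'D_v (u z) x).
Proof.
rewrite (derive_sum_fct (g := fun z y => a z * softmax (u^~ y) z)); last first.
  by move=> z; exact/differentiableZ/differentiable_softmax.
rewrite mulr_suml -sumrB; apply: eq_bigr => z _.
rewrite (@deriveZ _ _ _ (fun y => softmax (u^~ y) z)); last first.
  exact/diff_derivable/differentiable_softmax.
by rewrite derive_softmax /GRing.scale/=; ring.
Qed.

End softmax_calculus.

(** * The exponential race in discrete time *)

Lemma argmax_measure_le (R : realType) (dT : measure_display)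
    (T : measurableType dT) (P : probability T R) (Z : finType)
    (gamma : Z -> {RV P >-> R}) (u : Z -> R) (zs : T -> Z) (z : Z) (s : R) :
  independent_family gamma -> (forall z, gumbel0_distributed (gamma z)) ->
  argmax_rv (fun w z => u z + gamma z w) zs -> 0 < s ->
  (P (zs @^-1` [set z]) <= (softmax u z * (1 + (\sum_y expR (u y)) * s))%:E)%E.
Proof.
move=> indep gumbel [mzs zsP] s0.
set c := euler_constant R.
(* Expected numbers of rings per step, at the rate of the clock of [z] and at the total rate;
   [a / b] is [softmax u z]. *)
set a := expR (u z) * s; set b := (\sum_y expR (u y)) * s.
have W0 := sum_expR_gt0 u z.
have a0 : 0 < a by rewrite mulr_gt0// expR_gt0.
have b0 : 0 < b by rewrite mulr_gt0.
(* The clock of [y] decreases in [x + u y], so a maximizer has the earliest ring. *)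
pose E y (x : R) := expR (- (x + c + u y)).
pose tail y (r : R) := [set x : R | r < E y x].
have mtail y r : measurable (tail y r).
  have mE : measurable_fun setT (E y).
    apply: measurableT_comp => //; apply: measurableT_comp => //.
    by apply: measurable_funD => //; apply: measurable_funD.
  rewrite (_ : tail y r = setT `&` E y @^-1` `]r, +oo[%classic).
    exact: mE.
  by rewrite setTI; apply/seteqP; split=> x /=; rewrite in_itv/= andbT.
(* [B k]: the exponential clock of [z] rings in []k s, (k + 1) s]] and no other
   clock rings up to time [k s]. *)
pose cell k y := if y == z then tail y (k%:R * s) `\` tail y (k.+1%:R * s)
                 else tail y (k%:R * s).
have mcell k y : measurable (cell k y).
  by rewrite /cell; case: ifP => _ //; apply: measurableD.
have s_ge0 k : 0 <= k%:R * s by rewrite mulr_ge0// ltW.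
pose B k := [set w | forall y, y \in [set: Z]%SET -> cell k y (gamma y w)].
(* The other clocks are compared with the grid time [k s], not with the ring of [z], so [B k]
   constrains each clock separately and independence applies. *)
have PB k : P (B k) = ((1 - expR (- a)) * expR (- b) ^+ k)%:E.
  rewrite indep// (bigD1 z)/= ?finset.in_setT//.
  have -> : P (gamma z @^-1` cell k z) =
      (expR (- (a * k%:R)) - expR (- (a * k.+1%:R)))%:E.
    rewrite /cell eqxx (_ : _ @^-1` _ =
      (gamma z @^-1` tail z (k%:R * s)) `\` (gamma z @^-1` tail z (k.+1%:R * s)))//.
    rewrite measureD//=; last 3 first.
    - exact: measurable_funPTI.
    - exact: measurable_funPTI.
    - by rewrite -ge0_fin_numE// fin_num_measure//; exact: measurable_funPTI.
    rewrite setIidr; last first.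
      by move=> w /=; apply: le_lt_trans; rewrite ler_pM2r// ler_nat.
    rewrite [X in (X - _)%E]gumbel0_exponential_tail//.
    rewrite [X in (_ - X)%E]gumbel0_exponential_tail// -EFinB.
    by rewrite /a; congr (expR (- _) - expR (- _))%:E; ring.
  rewrite (eq_bigr (fun y => (expR (- (expR (u y) * (k%:R * s))))%:E)).
    2: by move=> y /andP[_ /negbTE yz]; rewrite /cell yz gumbel0_exponential_tail.
  rewrite -(big_morph EFin (@EFinM R) erefl) -EFinM; congr EFin.
  rewrite (eq_bigl (fun y => y != z)); last by move=> y; rewrite finset.in_setT.
  rewrite -expR_sum -expRM_natl.
  (* The clock of [z] contributes [exp(-ak) - exp(-a(k+1))], the others [exp(-(b-a)k)]. *)
  have -> : b = a + (\sum_(y | y != z) expR (u y)) * s.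
    by rewrite /b (bigD1 z)//= mulrDl.
  rewrite sumrN -mulr_suml mulrBl [in RHS]mulrBl mul1r -!expRD.
  by congr (expR _ - expR _); rewrite -?[k.+1%:R]natr1; ring.
(* Take the least [k] such that the clock of [z] has rung by time [(k+1)s]; minimality puts the ring
   after [ks], and the other clocks ring no earlier. *)
have cover : zs @^-1` [set z] `<=` \bigcup_k B k.
  move=> w /= zw.
  have exE : exists n, E z (gamma z w) <= n.+1%:R * s.
    exists (Num.bound (E z (gamma z w) / s)).
    rewrite -ler_pdivrMr// ltW// (lt_le_trans (archi_boundP _))//.
      by rewrite divr_ge0 ?expR_ge0 ?ltW.
    by rewrite ler_nat.
  case: (ex_minnP exE) => k Ek kmin.
  have kE : k%:R * s < E z (gamma z w).
    case: k Ek kmin => [|k] Ek kmin; first by rewrite mul0r expR_gt0.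
    by rewrite ltNge; apply/negP => /kmin; rewrite ltnn.
  exists k => // y _; rewrite /cell; case: eqP => [->|_].
    by split=> //=; apply/negP; rewrite -leNgt.
  apply: (lt_le_trans kE); rewrite ler_expR.
  by have := zsP w y; rewrite zw; lra.
have mB k : measurable (B k).
  rewrite (_ : B k = \bigcap_(y in [set: Z]) (gamma y @^-1` cell k y)).
    by apply: fin_bigcap_measurable => // y _; exact: measurable_funPTI.
  by apply/seteqP; split=> w Bw y yZ; apply: Bw => //; rewrite finset.in_setT.
have : (P (zs @^-1` [set z]) <= \sum_(k <oo) P (B k))%E.
  exact: measure_sigma_subadditive.
move=> /le_trans; apply.
(* It suffices to bound every partial sum of the geometric series. *)
apply: lime_le; first exact: is_cvg_nneseries.
apply: nearW => n.
rewrite (eq_bigr (fun k => ((1 - expR (- a)) * expR (- b) ^+ k)%:E)) => [|k _].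
  2: exact: PB.
rewrite sumEFin lee_fin -mulr_sumr big_mkord.
have q1 : expR (- b) < 1 by rewrite expR_lt1 oppr_lt0.
have q0 := expR_gt0 (- b).
have geo : (1 - expR (- b)) * (\sum_(i < n) expR (- b) ^+ i) <= 1.
  have := subrX1 (expR (- b)) n.
  have := exprn_ge0 n (ltW q0); nra.
have ea : 1 - expR (- a) <= a by have := expR_ge1Dx (- a); lra.
(* Multiplying [1 + b <= exp(b)] by [exp(-b)] gives [exp(-b)(1 + b) <= 1]. *)
have eb : b <= (1 - expR (- b)) * (1 + b).
  have := expR_ge1Dx b; have : expR (- b) * expR b = 1 by rewrite -expRD addNr expR0.
  nra.
set S := \sum_(_ < _) _ in geo *.
have S0 : 0 <= S by rewrite sumr_ge0// => i _; exact: exprn_ge0 (ltW q0).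
apply: (@le_trans _ _ (a * S)); first by rewrite ler_wpM2r.
rewrite (_ : softmax u z * (1 + b) = a * ((1 + b) / b)); last first.
  by rewrite /softmax /a /b; field; rewrite !gt_eqF.
rewrite ler_pM2l// ler_pdivlMr//.
have : b * S <= (1 - expR (- b)) * (1 + b) * S by rewrite ler_wpM2r.
nra.
Qed.

(** * Expectations of finite-valued variables and the Gumbel-max law *)

Section expectation_finType.
Context {R : realType} {dT : measure_display} {T : measurableType dT}.
Context (P : probability T R) {Z : finType} (zs : T -> Z) (a : Z -> R).
Hypothesis mzs : forall z, measurable (zs @^-1` [set z]).

(** Writing the variable as a finite combination of indicators of fibres yields both integrability
    and the mean. *)
Let comp_indic (w : T) :
  (a (zs w))%:E = (\sum_z (a z)%:E * (\1_(zs @^-1` [set z]) w)%:E)%E.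
Proof.
under eq_bigr do rewrite -EFinM.
rewrite sumEFin (bigD1 (zs w))//= big1 => [|z /eqP zw].
  by rewrite indicE mem_set// mulr1 addr0.
by rewrite indicE memNset ?mulr0//= => zsw; apply: zw.
Qed.

Let integrable_term (z : Z) :
  P.-integrable setT (fun w => (a z)%:E * (\1_(zs @^-1` [set z]) w)%:E)%E.
Proof. by apply: integrableZl => //; exact: integrable_indic. Qed.

Lemma Lfun1_finType : (fun w => a (zs w)) \in Lfun P 1.
Proof.
apply/Lfun1_integrable; rewrite (_ : EFin \o _ =
    fun w => (\sum_z (a z)%:E * (\1_(zs @^-1` [set z]) w)%:E)%E).
  exact: integrable_sum.
by apply/funext => w; exact: comp_indic.
Qed.

Lemma expectation_finType :
  ('E_P[fun w => a (zs w)])%E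
  = (\sum_z a z * fine (P (zs @^-1` [set z])))%:E.
Proof.
rewrite unlock; under eq_integral do rewrite comp_indic.
rewrite integral_sum// -sumEFin; apply: eq_bigr => z _.
rewrite integralZl//; last exact: integrable_indic.
by rewrite integral_indic// setIT EFinM fineK// fin_num_measure.
Qed.

End expectation_finType.

(* The upper bounds on the probabilities are attained because both families sum
   to [1]; no matching lower bound is needed. *)
Lemma gumbel_max (R : realType) (dT : measure_display)
    (T : measurableType dT) (P : probability T R) (Z : finType)
    (gamma : Z -> {RV P >-> R}) (u : Z -> R) (zs : T -> Z) (z : Z) :
  independent_family gamma -> (forall z, gumbel0_distributed (gamma z)) ->
  argmax_rv (fun w z => u z + gamma z w) zs ->
  fine (P (zs @^-1` [set z])) = softmax u z.
Proof.
move=> indep gumbel zsP; have [mzs _] := zsP.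
set p := fun y => fine (P (zs @^-1` [set y])).
have W0 := sum_expR_gt0 u z.
have le_p y : p y <= softmax u y.
  apply/ler_addgt0Pr => e e0.
  have q0 : 0 < softmax u y by rewrite divr_gt0 ?expR_gt0.
  (* For this time step the bound exceeds [softmax u y] by exactly [e]. *)
  have s0 : 0 < e / (softmax u y * \sum_y expR (u y)).
    by rewrite divr_gt0// mulr_gt0.
  have := argmax_measure_le y indep gumbel zsP s0.
  rewrite -(@fineK _ (P _)) ?fin_num_measure// lee_fin => /le_trans; apply.
  rewrite le_eqVlt; apply/orP; left; apply/eqP.
  by field; rewrite !gt_eqF.
have sum_p : \sum_y p y = 1.
  (* Total mass 1 is the expectation of the constant 1. *)
  have := expectation_finType P (fun=> 1) mzs.
  rewrite (_ : (fun=> 1) = cst 1)// expectation_cst => -[->].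
  by apply: eq_bigr => y _; rewrite mul1r.
apply/eqP; rewrite -/(p z) eq_le le_p/=.
have := sum_p; rewrite -(sum_softmax u z) (bigD1 z)//= [in RHS](bigD1 z)//=.
have : \sum_(y | y != z) p y <= \sum_(y | y != z) softmax u y.
  by apply: ler_sum => y _; exact: le_p.
lra.
Qed.

(** * The gradient identity *)

Theorem theorem1 (R : realType) (dT : measure_display) (T : measurableType dT)
    (P : probability T R) (Z : finType) (Z_gt0 : (0 < #|Z|)%N) (d : nat)
    (f : Z -> R) (h : 'rV[R]_d -> Z -> R)
    (h_smooth : forall z, smooth (fun phi => h phi z))
    (gamma : Z -> {RV P >-> R})
    (gamma_indep : independent_family gamma)
    (gamma_gumbel : forall z, gumbel0_distributed (gamma z))
    (zstar : 'rV[R]_d -> T -> Z)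
    (zstarP : forall phi,
      argmax_rv (fun w z => h phi z + gamma z w) (zstar phi))
    (zstar_eps : 'rV[R]_d -> R -> T -> Z)
    (zstar_epsP : forall phi eps,
      argmax_rv (fun w z => eps * f z + h phi z + gamma z w)
                (zstar_eps phi eps))
    (phi : 'rV[R]_d) :
  let F := fun psi : 'rV[R]_d => fine 'E_P[fun w => f (zstar psi w)] in
  let gradh := fun z : Z => gradient (fun psi => h psi z) phi in
  differentiable F phi /\
  (eps^-1 *: expectation_rV P
     (fun w => gradh (zstar_eps phi eps w) - gradh (zstar phi w))
     @[eps --> (0 : R)^'] --> gradient F phi).
Proof.
move=> F gradh.
have dh z : differentiable (fun psi => h psi z) phi by exact: (h_smooth z [::]).
have FE : F = fun psi => \sum_z f z * softmax (h psi) z.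
  apply/funext => psi; rewrite /F expectation_finType; last first.
    by have [] := zstarP psi.
  apply: eq_bigr => z _.
  by rewrite (gumbel_max (u := h psi) z gamma_indep gamma_gumbel (zstarP psi)).
split.
  by rewrite FE; exact: (differentiable_softmax_mean (u := fun z psi => h psi z)).
pose u z (e : R) := e * f z + h phi z.
have is_du z : is_derive (0 : R) 1 (u z) (f z).
  by apply: is_derive_eq; rewrite /GRing.scale/=; ring.
have du z : differentiable (u z) (0 : R).
  by apply/derivable1_diffP; case: (is_du z).
have Du z : 'D_1 (u z) (0 : R) = f z by apply: derive_val.
have u0 : u^~ 0 = h phi by apply/funext => z; rewrite /u mul0r add0r.
pose a i z := gradh z ord0 i.
(* Mean of the gradient of [h] at the fixed [phi] under softmax of [e f + h phi]; the limit is its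
   derivative at 0. *)
pose M (e : R) : 'rV[R]_d := \row_i \sum_z a i z * softmax (u^~ e) z.
have dM : derivable M (0 : R) 1.
  apply/derivable_mxP => j i.
  rewrite (_ : (fun _ => _) = fun e => \sum_z a i z * softmax (u^~ e) z).
    exact/diff_derivable/differentiable_softmax_mean.
  by apply/funext => e; rewrite mxE.
(* Componentwise, both sides are the covariance of [f] and a partial derivative of [h], with the two
   factors exchanged. *)
have -> : gradient F phi = 'D_1 M (0 : R).
  rewrite derive_mx//; apply/matrixP => j i; rewrite !mxE ord1.
  rewrite (_ : (fun _ => _) = fun e => \sum_z a i z * softmax (u^~ e) z).
    rewrite derive_softmax_mean// u0 /partial FE.
    rewrite (derive_softmax_mean (u := fun z psi => h psi z))//.
    congr (_ - _).
      by apply: eq_bigr => z _; rewrite Du /a /gradh mxE /partial [f z * _]mulrC.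
    rewrite mulrC; congr (_ * _); apply: eq_bigr => z _.
      by rewrite /a /gradh mxE.
    by rewrite Du.
  by apply/funext => e; rewrite mxE.
(* Only the laws of the two maximizers enter, so their tie-breaking rules may differ, even at
   [e = 0]. *)
have EM (e : R) : expectation_rV P
    (fun w => gradh (zstar_eps phi e w) - gradh (zstar phi w)) = M e - M 0.
  apply/rowP => i; rewrite !mxE.
  under eq_fun do rewrite mxE [X in _ + X]mxE.
  have [mz _] := zstar_epsP phi e; have [mz0 _] := zstarP phi.
  rewrite (expectationB (X := fun w => a i (zstar_eps phi e w))
    (Y := fun w => a i (zstar phi w))); [|exact: Lfun1_finType..].
  rewrite !expectation_finType//=.
  congr (_ - _); apply: eq_bigr => z _.
    by rewrite (gumbel_max (u := u^~ e) z gamma_indep gamma_gumbel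
      (zstar_epsP phi e)).
  by rewrite u0 (gumbel_max (u := h phi) z gamma_indep gamma_gumbel
    (zstarP phi)).
(* This is the difference quotient in the definition of [derivable], in direction 1. *)
rewrite (_ : (fun eps => _) =
    fun e => e^-1 *: ((M \o shift (0 : R)) (e *: 1) - M 0)); first exact: dM.
by apply/funext => e; rewrite EM /= addr0 /GRing.scale/= mulr1.
Qed.
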